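(* Let $k\ge1$, $p\ge1$ and $y\in[0,\infty)$ be given. An optimal $k$-step additive linear multistep method of order $p$ with SSP coefficient $\mathcal{C}_{k,p}=\mathcal{C}_{k,p}(y)$ and corresponding SSP coefficient $\widehat{\mathcal{C}}_{k,p}=y\,\mathcal{C}_{k,p}(y)$ is equivalent to the optimal $k$-step SSP linear multistep method of order $p$ with SSP coefficient $\mathcal{C}_{k,p}+\widehat{\mathcal{C}}_{k,p}$; that is, its coefficients satisfy $\beta_j=\hat\beta_j$ for all $j$, and the (non-additive) linear multistep method with coefficients $\alpha_j,\beta_j$ is the optimal $k$-step SSP linear multistep method of order $p$, with SSP coefficient $\mathcal{C}_{k,p}+\widehat{\mathcal{C}}_{k,p}$.
   Context: A $k$-step additive linear multistep method for $\mathbf{u}'=\mathbf{F}(\mathbf{u})+\widehat{\mathbf{F}}(\mathbf{u})$ is given by real coefficients $\alpha_0,\dots,\alpha_{k-1}$, $\beta_0,\dots,\beta_k$, $\hat\beta_0,\dots,\hat\beta_k$, and reads $$\mathbf{u}_n=\sum_{j=0}^{k-1}\alpha_j\mathbf{u}_{n-k+j}+\Delta t\sum_{j=0}^k\left(\beta_j\mathbf{F}(\mathbf{u}_{n-k+j})+\hat\beta_j\widehat{\mathbf{F}}(\mathbf{u}_{n-k+j})\right).$$ It is explicit if $\beta_k=\hat\beta_k=0$. It has order $p$ if $\sum_{j=0}^{k-1}\alpha_j=1$, $\sum_{j=0}^{k-1}j\alpha_j+\sum_{j=0}^k\beta_j=k$, $\sum_{j=0}^{k-1}j\alpha_j+\sum_{j=0}^k\hat\beta_j=k$,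 and for $i\in\{2,\dots,p\}$ both $\sum_{j=0}^{k-1}\alpha_jj^i+\sum_{j=0}^k\beta_j\,i\,j^{i-1}=k^i$ and $\sum_{j=0}^{k-1}\alpha_jj^i+\sum_{j=0}^k\hat\beta_j\,i\,j^{i-1}=k^i$. Monotonicity conditions for $(r,\hat r)$, $r,\hat r\ge0$: $\beta_j,\hat\beta_j\ge0$ for $j\in\{0,\dots,k\}$, and $\alpha_j-r\beta_j-\hat r\hat\beta_j\ge0$ for $j\in\{0,\dots,k-1\}$. The method is strong-stability-preserving (SSP) if these conditions hold for some such $r,\hat r$. For fixed $y=\hat r/r$, the method has SSP coefficient $$\mathcal{C}(y)=\sup\{r\ge0:\ \text{the monotonicity conditions hold with }\hat r=yr\}$$ and corresponding coefficient $\widehat{\mathcal{C}}(y)=y\,\mathcal{C}(y)$. $\mathcal{C}_{k,p}(y)$ is the supremum of all $\mathcal{C}(y)>0$ that are SSP coefficients of $k$-step additive linear multistep methods of order $p$; a $k$-step SSP additive method of order $p$ is optimal if $\mathcal{C}(y)=\mathcal{C}_{k,p}(y)$. A (non-additive) $k$-step linear multistep method is $\mathbf{u}_n=\sum_{j=0}^{k-1}\alpha_j\mathbf{u}_{n-k+j}+\Delta t\sum_{j=0}^k\beta_j\mathbf{F}(\mathbf{u}_{n-k+j})$ (explicit if $\beta_k=0$); it has order $p$ if $\sum_{j=0}^{k-1}\alpha_j=1$, $\sum_{j=0}^{k-1}j\alpha_j+\sum_{j=0}^k\beta_j=k$, and $\sum_{j=0}^{k-1}\alpha_jj^i+\sum_{j=0}^k\beta_j\,i\,j^{i-1}=k^i$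 for $i\in\{2,\dots,p\}$; when all $\alpha_j,\beta_j\ge0$ its SSP coefficient is $\min_{0\le j\le k-1}\alpha_j/\beta_j$, where the ratio is taken to be $\infty$ if $\beta_j=0$; for a fixed number of steps and order, it is optimal if it attains the largest possible SSP coefficient. The result is meant both for methods whose two parts are both allowed to be implicit and for methods whose two parts are both explicit, with optimality in the latter case understood among explicit methods.
   Formalization: The equality of β_j and β̂_j is claimed only for y > 0, since it fails at y = 0 (e.g. explicit k=2, p=1, α=(0,1), β=(0,1,0), β̂=(1,0,0)); at y = 0 it is instead shown that replacing β̂ by β keeps the method optimal. *)

(* Defs.v *)
From mathcomp Require Import all_boot all_order all_algebra.
From mathcomp Require Import all_classical all_reals all_analysis.

Set Implicit Arguments.
Unset Strict Implicit.
Unset Printing Implicit Defensive.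

Import Order.TTheory GRing.Theory Num.Theory.
Local Open Scope ring_scope.
Local Open Scope classical_set_scope.
Local Open Scope ereal_scope.

(* [Explicit]: the coefficients of index k vanish; [Implicit]: no restriction,
   so explicit methods belong to this class as well. *)
Inductive method_class := Implicit | Explicit.

(* alpha is indexed by {0, ..., k-1} and beta by {0, ..., k}; the embedding of
   the former index set in the latter. *)
Definition widx {k : nat} (j : 'I_k) : 'I_k.+1 := widen_ord (leqnSn k) j.

Definition order_conditions (R : realType) (k p : nat)
    (alpha : 'I_k -> R) (beta : 'I_k.+1 -> R) : Prop :=
  [/\ (\sum_(j < k) alpha j = 1)%R,
      (\sum_(j < k) j%:R * alpha j + \sum_(j < k.+1) beta j = k%:R)%R
    & forall i : nat, (2 <= i <= p)%N ->
        (\sum_(j < k) alpha j * j%:R ^+ i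
         + \sum_(j < k.+1) beta j * i%:R * j%:R ^+ i.-1 = k%:R ^+ i)%R].

Record lmm (R : realType) (k : nat) := LMM {
  lmm_alpha : 'I_k -> R;
  lmm_beta : 'I_k.+1 -> R }.

Definition lmm_in_class (R : realType) (k : nat) (c : method_class)
    (m : lmm R k) : Prop :=
  match c with Implicit => True | Explicit => lmm_beta m ord_max = 0%R end.

Definition lmm_order (R : realType) (k p : nat) (m : lmm R k) : Prop :=
  order_conditions p (lmm_alpha m) (lmm_beta m).

Definition lmm_nonneg (R : realType) (k : nat) (m : lmm R k) : Prop :=
  (forall j, 0 <= lmm_alpha m j)%R /\ (forall j, 0 <= lmm_beta m j)%R.

(* Only meaningful when [lmm_nonneg m]. *)
Definition lmm_ssp_coef (R : realType) (k : nat) (m : lmm R k) : \bar R :=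
  \big[Order.min/+oo]_(j < k)
    (if lmm_beta m (widx j) == 0%R then +oo
     else (lmm_alpha m j / lmm_beta m (widx j))%:E).

Definition lmm_optimal (R : realType) (k : nat) (c : method_class) (p : nat)
    (m : lmm R k) : Prop :=
  [/\ lmm_in_class c m, lmm_order p m, lmm_nonneg m
    & forall m' : lmm R k,
        lmm_in_class c m' -> lmm_order p m' -> lmm_nonneg m' ->
        lmm_ssp_coef m' <= lmm_ssp_coef m].

Record almm (R : realType) (k : nat) := ALMM {
  almm_alpha : 'I_k -> R;
  almm_beta : 'I_k.+1 -> R;
  almm_hbeta : 'I_k.+1 -> R }.

Definition almm_in_class (R : realType) (k : nat) (c : method_class)
    (m : almm R k) : Prop :=
  match c with
  | Implicit => True
  | Explicit => almm_beta m ord_max = 0%R /\ almm_hbeta m ord_max = 0%R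
  end.

Definition almm_order (R : realType) (k p : nat) (m : almm R k) : Prop :=
  order_conditions p (almm_alpha m) (almm_beta m) /\
  order_conditions p (almm_alpha m) (almm_hbeta m).

Definition monotonicity_conditions (R : realType) (k : nat) (m : almm R k)
    (r rh : R) : Prop :=
  (forall j, 0 <= almm_beta m j /\ 0 <= almm_hbeta m j)%R /\
  (forall j : 'I_k,
     0 <= almm_alpha m j - r * almm_beta m (widx j)
          - rh * almm_hbeta m (widx j))%R.

Definition almm_ssp (R : realType) (k : nat) (m : almm R k) : Prop :=
  exists r rh : R,
    [/\ (0 <= r)%R, (0 <= rh)%R & monotonicity_conditions m r rh].

(* +oo when the conditions hold for arbitrarily large r, as for backward Euler
   used on both parts. For y = 0 the coefficients hbeta are only required to be
   nonnegative, so they are not determined by optimality. *)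
Definition almm_ssp_coef (R : realType) (k : nat) (y : R) (m : almm R k) :
    \bar R :=
  ereal_sup [set r%:E | r in
    [set r : R | (0 <= r)%R /\ monotonicity_conditions m r (y * r)%R]].

(* The supremum is -oo if no method has a positive coefficient; then no method
   is optimal, since SSP methods have a nonnegative coefficient. *)
Definition almm_best_coef (R : realType) (c : method_class) (k p : nat)
    (y : R) : \bar R :=
  ereal_sup [set x : \bar R | 0 < x /\ exists m : almm R k,
    [/\ almm_in_class c m, almm_order p m & x = almm_ssp_coef y m]].

Definition almm_optimal (R : realType) (k : nat) (c : method_class) (p : nat)
    (y : R) (m : almm R k) : Prop :=
  [/\ almm_in_class c m, almm_order p m, almm_ssp m
    & almm_ssp_coef y m = almm_best_coef c k p y].

Definition lmm_of_almm (R : realType) (k : nat) (m : almm R k) : lmm R k :=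
  LMM (almm_alpha m) (almm_beta m).

Definition almm_of_lmm (R : realType) (k : nat) (m : lmm R k) : almm R k :=
  ALMM (lmm_alpha m) (lmm_beta m) (lmm_beta m).

(* Main.v *)
(* Averaging the two parts of an additive method with weights 1 : y yields a
   linear multistep method of the same order with SSP coefficient
   (1 + y) C(y), and using one method for both parts goes back; so optimal
   additive methods average to optimal methods. An optimal method with
   positive SSP coefficient has at most p nonzero beta_j, since otherwise the
   order conditions leave room to increase the coefficient. For y > 0 the
   difference beta - hbeta is supported on these indices and its moments of
   order less than p vanish, so it is zero (Vandermonde). *)

Require Import Defs.
From mathcomp Require Import all_boot all_order all_algebra.
From mathcomp Require Import all_classical all_reals all_analysis.
From mathcomp Require Import ring lra.

Set Implicit Arguments.
Unset Strict Implicit.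
Unset Printing Implicit Defensive.

Import Order.TTheory GRing.Theory Num.Theory.
Local Open Scope ring_scope.

(** * Reformulations of order and SSP coefficient *)

(** At [i = 0] the factor [i] kills the [beta] sum, so all the order conditions share one formula
    and can be treated by one computation. *)
Lemma order_conditionsP (R : realType) (k p : nat) (alpha : 'I_k -> R)
    (beta : 'I_k.+1 -> R) : (1 <= p)%N ->
  order_conditions p alpha beta <->
  forall i : nat, (i <= p)%N ->
    \sum_(j < k) alpha j * j%:R ^+ i
    + \sum_(j < k.+1) beta j * i%:R * j%:R ^+ i.-1 = k%:R ^+ i.
Proof.
move=> p1.
have e0 : \sum_(j < k) alpha j * j%:R ^+ 0
    + \sum_(j < k.+1) beta j * 0%:R * j%:R ^+ 0.-1 = \sum_(j < k) alpha j.
  rewrite [X in _ + X]big1 ?addr0; last by move=> j _; rewrite mulr0 mul0r.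
  by apply: eq_bigr => j _; rewrite mulr1.
have e1 : \sum_(j < k) alpha j * j%:R ^+ 1
    + \sum_(j < k.+1) beta j * 1%:R * j%:R ^+ 1.-1
    = \sum_(j < k) j%:R * alpha j + \sum_(j < k.+1) beta j.
  congr (_ + _); apply: eq_bigr => j _; first by rewrite mulrC.
  by rewrite !mulr1.
split=> [[h0 h1 h2] [|[|i]] ip|h].
- by rewrite e0.
- by rewrite e1.
- exact: h2.
- split; first by rewrite -e0 h.
  + by rewrite -e1 h.
  + by move=> i /andP[_ ip]; exact: h.
Qed.

(** Clearing denominators: the value [+oo] at a vanishing [beta] matches the inequality
    [0 <= alpha], which holds by nonnegativity. *)
Lemma lmm_ssp_coef_geP (R : realType) (k : nat) (l : lmm R k) (r : R) :
  lmm_nonneg l ->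
  (r%:E <= lmm_ssp_coef l)%E <->
  forall j, r * lmm_beta l (widx j) <= lmm_alpha l j.
Proof.
move=> [al0 be0].
have E (j : 'I_k) : (r%:E <= if lmm_beta l (widx j) == 0%R then +oo
     else (lmm_alpha l j / lmm_beta l (widx j))%:E)%E
    = (r * lmm_beta l (widx j) <= lmm_alpha l j).
  case: eqP => [->|/eqP b0]; first by rewrite leey mulr0 al0.
  by rewrite lee_fin ler_pdivlMr // lt_neqAle eq_sym b0 be0.
rewrite /lmm_ssp_coef; split=> [h j|h].
  by rewrite -E; apply: (le_trans h); exact: bigmin_le.
by apply/bigmin_geP; split=> [|j _]; [exact: leey|rewrite E].
Qed.

Lemma lmm_ssp_coef_ge0 (R : realType) (k : nat) (l : lmm R k) :
  lmm_nonneg l -> (0 <= lmm_ssp_coef l)%E.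
Proof.
move=> l0; apply/(lmm_ssp_coef_geP _ l0) => j.
by rewrite mul0r; case: l0.
Qed.

Lemma almm_ssp_mono0 (R : realType) (k : nat) (m : almm R k) :
  almm_ssp m -> monotonicity_conditions m 0 0.
Proof.
move=> [r [rh [r0 rh0 [b0 h]]]]; split=> // j.
have [b1 b2] := b0 (widx j).
rewrite !mul0r !subr0; apply: (le_trans (h j)).
by rewrite -addrA -opprD gerBl addr_ge0// mulr_ge0.
Qed.

(** * Averaging the two parts of an additive method *)

(* Weights 1 : y, so that the LMM constraint alpha_j >= s beta_j for
   s = r (1 + y) is the additive constraint for the pair (r, y r). *)
Definition blend (R : realType) (k : nat) (y : R) (m : almm R k) : lmm R k :=
  LMM (almm_alpha m)
    (fun j => (almm_beta m j + y * almm_hbeta m j) / (1 + y)).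

Lemma blend_in_class (R : realType) (k : nat) (c : method_class) (y : R)
    (m : almm R k) :
  almm_in_class c m -> lmm_in_class c (blend y m).
Proof.
by case: c => //= -[-> ->]; rewrite mulr0 addr0 mul0r.
Qed.

(** For fixed [alpha] the order conditions are affine in [beta], so an average with weights of sum 1
    preserves them. *)
Lemma blend_order (R : realType) (k p : nat) (y : R) (m : almm R k) :
  (1 <= p)%N -> 0 <= y -> almm_order p m -> lmm_order p (blend y m).
Proof.
move=> p1 y0 [/(order_conditionsP _ _ p1) h1].
move=> /(order_conditionsP _ _ p1) h2.
apply/order_conditionsP => // i ip /=.
have y1 : 1 + y != 0 by rewrite gt_eqF// ltr_pwDl.
have -> : \sum_(j < k.+1) (almm_beta m j + y * almm_hbeta m j) / (1 + y)
       * i%:R * j%:R ^+ i.-1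
  = (\sum_(j < k.+1) almm_beta m j * i%:R * j%:R ^+ i.-1
     + y * \sum_(j < k.+1) almm_hbeta m j * i%:R * j%:R ^+ i.-1) / (1 + y).
  rewrite mulr_sumr -big_split mulr_suml; apply: eq_bigr => j _ /=.
  by field.
have := h1 i ip; have := h2 i ip.
set A := \sum_(_ < _) _; set B := \sum_(_ < _) _; set D := \sum_(_ < _) _.
move=> e2 e1; have -> : B = k%:R ^+ i - A by rewrite -e2; ring.
have -> : D = k%:R ^+ i - A by rewrite -e1; ring.
by field.
Qed.

Lemma blend_nonneg (R : realType) (k : nat) (y : R) (m : almm R k) :
  0 <= y -> monotonicity_conditions m 0 0 -> lmm_nonneg (blend y m).
Proof.
move=> y0 [b0 a0]; split=> j /=.
  by have := a0 j; rewrite !mul0r !subr0.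
have [? ?] := b0 j.
by rewrite divr_ge0 ?addr_ge0 ?mulr_ge0.
Qed.

Lemma blend_almm_of_lmm (R : realType) (k : nat) (y : R) (l : lmm R k) :
  0 <= y -> blend y (almm_of_lmm l) = l.
Proof.
move=> y0; case: l => al be; rewrite /blend /=; congr LMM.
apply/funext => j.
have y1 : 1 + y != 0 by rewrite gt_eqF// ltr_pwDl.
by field.
Qed.

(** The monotonicity conditions at [(r, y * r)] amount to [(1 + y) * r <= lmm_ssp_coef (blend y m)],
    so the admissible [r >= 0] fill an interval whose right end is that coefficient divided by
    [1 + y]. *)
Lemma blend_ssp_coef (R : realType) (k : nat) (y : R) (m : almm R k) :
  0 <= y -> monotonicity_conditions m 0 0 ->
  lmm_ssp_coef (blend y m) = ((1 + y)%:E * almm_ssp_coef y m)%E.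
Proof.
move=> y0 m0; have l0 := blend_nonneg y0 m0.
have y1 : 0 < 1 + y by rewrite ltr_pwDl.
have yn : 1 + y != 0 by rewrite gt_eqF.
have setE (r : R) : monotonicity_conditions m r (y * r) <->
    (((1 + y) * r)%:E <= lmm_ssp_coef (blend y m))%E.
  rewrite lmm_ssp_coef_geP //=.
  have E j : ((1 + y) * r * ((almm_beta m (widx j) + y * almm_hbeta m (widx j))
      / (1 + y)) <= almm_alpha m j) = (0 <= almm_alpha m j
      - r * almm_beta m (widx j) - y * r * almm_hbeta m (widx j)).
    rewrite -subr_ge0; congr (0 <= _); by field.
  split=> [[_ h] j|h]; first by rewrite E.
  by split=> [|j]; [case: m0|rewrite -E].
apply/eqP; rewrite eq_le; apply/andP; split.
  have := lmm_ssp_coef_ge0 l0.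
  case El : (lmm_ssp_coef _) => [s| |] //; last first.
    move=> _; have -> : almm_ssp_coef y m = +oo%E; last by rewrite gt0_muley.
    (* Only nonnegative numbers are admissible, hence [Num.max r 0]. *)
    apply/eq_infty => r; apply: (@le_trans _ _ (Num.max r 0)%:E).
      by rewrite lee_fin le_max lexx.
    apply: ereal_sup_ubound; exists (Num.max r 0) => //; split.
      by rewrite le_max lexx orbT.
    by apply/setE; rewrite El leey.
  rewrite lee_fin => s0.
  have -> : s%:E = ((1 + y)%:E * (s / (1 + y))%:E)%E.
    by rewrite -EFinM mulrC divfK.
  rewrite lee_pmul2l//; apply: ereal_sup_ubound; exists (s / (1 + y)) => //.
  split; first by rewrite divr_ge0// ltW.
  by apply/setE; rewrite El mulrC divfK.
rewrite -lee_pdivlMl//; apply: ge_ereal_sup => _ [r [r0 /setE h] <-].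
by rewrite lee_pdivlMl// -EFinM.
Qed.

(** * Solvability of the perturbation equations *)

(* A row dependency is a polynomial P of degree at most p such that s P + P',
   which has the degree of P, vanishes at the p + 1 points x t. *)
Lemma shifted_vandermonde_solvable (F : numFieldType) (p : nat) (s : F)
    (x w : 'I_p.+1 -> F) : s != 0 -> injective x ->
  exists v : 'I_p.+1 -> F, forall i : 'I_p.+1,
    \sum_t v t * (s * x t ^+ i + i%:R * x t ^+ i.-1) = w i.
Proof.
move=> s0 xI.
pose B := \matrix_(t < p.+1, i < p.+1) (s * x t ^+ i + i%:R * x t ^+ i.-1).
suff BU : B \in unitmx.
  exists (((\row_i w i) *m invmx B) 0) => i.
  have := mulmxKV BU (\row_i w i) => /rowP/(_ i).
  rewrite !mxE => <-; apply: eq_bigr => t _; by rewrite !mxE.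
rewrite -unitmx_tr -row_free_unit; apply: inj_row_free => q qB.
pose P := \poly_(i < p.+1) q 0 (inord i).
suff P0 : P = 0.
  apply/rowP => i; rewrite mxE; have := coef0 F i.
  by rewrite -P0 coef_poly ltn_ord inord_val.
apply/eqP; apply: contraT => Pn0.
have sz : size (s *: P + P^`()) = size P.
  by rewrite size_polyDl size_scale// lt_size_deriv.
have Q0 : s *: P + P^`() != 0 by rewrite -size_poly_eq0 sz size_poly_eq0.
have := max_poly_roots Q0 (rs := map x (enum 'I_p.+1)).
rewrite map_inj_uniq ?enum_uniq// size_map size_enum_ord sz.
rewrite ltnNge size_poly; apply => //.
apply/allP => _ /mapP[t _ ->]; apply/eqP.
move: qB => /rowP/(_ t); rewrite !mxE => <-.
rewrite /P poly_def hornerD hornerZ linear_sum !horner_sum mulr_sumr -big_split.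
apply: eq_bigr => i _ /=.
rewrite inord_val !mxE derivZ derivXn !hornerZ hornerMn !hornerXn.
by rewrite -mulr_natl; ring.
Qed.

(** Any [p + 1] indices of [J] serve as distinct nodes; the solution there is extended by zero. *)
Lemma support_solvable (F : numFieldType) (n p : nat) (s : F) (J : {set 'I_n})
    (w : nat -> F) : s != 0 -> (p < #|J|)%N ->
  exists2 v : 'I_n -> F, (forall j, j \notin J -> v j = 0) &
    forall i, (i <= p)%N ->
      \sum_j v j * (s * j%:R ^+ i + i%:R * j%:R ^+ i.-1) = w i.
Proof.
move=> s0 pJ.
pose f (t : 'I_p.+1) : 'I_n := enum_val (widen_ord pJ t).
have fI : injective (fun t => (f t)%:R : F).
  move=> t u /eqP; rewrite eqr_nat => /eqP/val_inj/enum_val_inj/(congr1 val) /=.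
  exact: val_inj.
have [v hv] := @shifted_vandermonde_solvable F p s _ (w \o val) s0 fI.
exists (fun j => \sum_(t | f t == j) v t) => [j jJ|i ip].
  by rewrite big_pred0// => t; apply: contraNF jJ => /eqP <-; exact: enum_valP.
have /= <- := hv (Ordinal (ip : (i < p.+1)%N)).
rewrite (partition_big f xpredT) //=; apply: eq_bigr => j _.
by rewrite mulr_suml; apply: eq_bigr => t /eqP ->.
Qed.

Lemma exists_small_multiplier (F : realFieldType) (I : finType) (c : F)
    (a b : I -> F) : 0 < c -> (forall j, 0 <= a j) -> (forall j, 0 < b j) ->
  exists2 e, 0 < e <= c & forall j, e * a j < b j.
Proof.
move=> c0 a0 b0.
(* The summand 1 keeps the denominators positive and makes the final inequality strict. *)
pose e := \big[Num.min/c]_j (b j / (1 + a j)).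
have d0 j : 0 < 1 + a j by rewrite ltr_pwDl.
have e0 : 0 < e by apply/bigmin_gtP; split=> // j _; rewrite divr_gt0.
exists e; first by rewrite e0; exact: bigmin_le_id.
move=> j; apply: (@lt_le_trans _ _ (e * (1 + a j))).
  by rewrite mulrDr mulr1 ltrDr.
by rewrite -ler_pdivlMr//; exact: bigmin_le.
Qed.

(** * Support of an optimal method *)

(* If p + 1 of the beta_j were positive, then for a suitable direction v on
   that support the method alpha + e (s v + 1), beta + e v would again satisfy
   the order conditions up to the factor 1 - e s v_k on the right-hand side
   (alpha_k, fixed to 0, cannot absorb e s v_k), and before rescaling each
   alpha_j - s beta_j with j < k would have increased by e > 0. *)
Lemma lmm_optimal_support (R : realType) (c : method_class) (k p : nat)
    (l : lmm R k) : (1 <= p)%N -> lmm_optimal c p l ->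
  (0 < lmm_ssp_coef l)%E -> (#|[set j | lmm_beta l j != 0%R]| <= p)%N.
Proof.
move=> p1 [lc lo ln lopt]; case El : (lmm_ssp_coef l) => [s| |] //; last first.
  (* If the coefficient is [+oo], every [beta_j] with [j < k] vanishes: otherwise
     [(alpha_j + 1) / beta_j] would be an admissible bound. Only the index [k] is left. *)
  move=> _; apply: leq_trans p1; rewrite -(cards1 (@ord_max k)).
  apply: subset_leq_card; apply/fintype.subsetP => j; rewrite !inE.
  apply: contraNT => jk.
  have jlt : (j < k)%N.
    rewrite ltn_neqAle -ltnS ltn_ord andbT; apply: contra jk => /eqP jk.
    exact/eqP/val_inj.
  have -> : j = widx (Ordinal jlt) by exact: val_inj.
  apply: contraT => bn0; have [a0 b0] := ln.
  have bp : 0 < lmm_beta l (widx (Ordinal jlt)) by rewrite lt_neqAle eq_sym bn0 b0.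
  have := (lmm_ssp_coef_geP
    ((lmm_alpha l (Ordinal jlt) + 1) / lmm_beta l (widx (Ordinal jlt))) ln).1.
  rewrite El leey => /(_ isT (Ordinal jlt)).
  by rewrite divfK// gerDl ler10.
rewrite lte_fin => s0; rewrite leqNgt; apply/negP => pJ.
set J := [set j | _] in pJ.
have [a0 b0] := ln.
(* This right-hand side cancels the moments of the constant 1 in the perturbation of [alpha]. *)
have [v vJ hv] := support_solvable
  (fun i => - \sum_(j < k) j%:R ^+ i) (lt0r_neq0 s0) pJ.
(* Outside [J] the direction [v] vanishes, so 1 is a dummy bound there. *)
pose b j := if j \in J then lmm_beta l j else 1.
have bp j : 0 < b j.
  by rewrite /b inE; case: eqP => //= /eqP bj; rewrite lt_neqAle eq_sym bj b0.
(* This cap on [e] keeps the rescaling factor [th] positive. *)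
have cp : 0 < (1 + `|s * v ord_max|)^-1 by rewrite invr_gt0 ltr_pwDl.
have [e /andP[e0 ec] ev] :=
  exists_small_multiplier cp (fun j => normr_ge0 (v j)) bp.
have th0 : 0 < 1 - e * (s * v ord_max).
  rewrite subr_gt0; apply: (@le_lt_trans _ _ (e * `|s * v ord_max|)).
    by rewrite ler_pM2l// ler_norm.
  apply: (@lt_le_trans _ _ (e * (1 + `|s * v ord_max|))).
    by rewrite ltr_pM2l// ltrDr.
  by rewrite -ler_pdivlMr ?mul1r// ltr_pwDl.
set th := 1 - _ in th0.
have th1 : th != 0 by rewrite gt_eqF.
pose l' := LMM (fun j => (lmm_alpha l j + e * (s * v (widx j) + 1)) / th)
  (fun j => (lmm_beta l j + e * v j) / th).
have gap j : s * lmm_beta l' (widx j) < lmm_alpha l' j.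
  rewrite /= mulrA ltr_pM2r ?invr_gt0//.
  have := (lmm_ssp_coef_geP s ln).1; rewrite El => /(_ (lexx _) j) h.
  by lra.
have b'0 j : 0 <= lmm_beta l' j.
  rewrite /= divr_ge0 ?(ltW th0)//.
  case: (boolP (j \in J)) => jJ; last by rewrite vJ// mulr0 addr0.
  have := ev j; rewrite /b jJ => h.
  have : e * - v j <= e * `|v j| by rewrite ler_pM2l// -normrN ler_norm.
  by lra.
have l'n : lmm_nonneg l'.
  split=> // j; apply: le_trans (ltW (gap j)).
  by rewrite mulr_ge0// ltW.
have l'c : lmm_in_class c l'.
  (* For explicit methods the index [k] lies outside [J], so [v] vanishes there. *)
  case: c lc {lopt} => //= bk.
  by rewrite bk vJ ?inE ?bk ?eqxx// mulr0 addr0 mul0r.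
have l'o : lmm_order p l'.
  apply/order_conditionsP => // i ip.
  move: lo => /(order_conditionsP _ _ p1)/(_ i ip) lo.
  have := hv i ip.
  have -> : \sum_(j < k.+1) v j * (s * j%:R ^+ i + i%:R * j%:R ^+ i.-1)
    = \sum_(j < k) s * v (widx j) * j%:R ^+ i + s * v ord_max * k%:R ^+ i
      + \sum_(j < k.+1) v j * i%:R * j%:R ^+ i.-1.
    rewrite -(@big_ord_recr _ _ _ k (fun j => s * v j * j%:R ^+ i)) -big_split.
    by apply: eq_bigr => j _ /=; ring.
  have -> : \sum_(j < k) lmm_alpha l' j * j%:R ^+ i =
    (\sum_(j < k) lmm_alpha l j * j%:R ^+ i
     + e * (\sum_(j < k) s * v (widx j) * j%:R ^+ i + \sum_(j < k) j%:R ^+ i)) / th.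
    rewrite -big_split mulr_sumr -big_split mulr_suml.
    by apply: eq_bigr => j _ /=; ring.
  have -> : \sum_(j < k.+1) lmm_beta l' j * i%:R * j%:R ^+ i.-1 =
    (\sum_(j < k.+1) lmm_beta l j * i%:R * j%:R ^+ i.-1
     + e * \sum_(j < k.+1) v j * i%:R * j%:R ^+ i.-1) / th.
    rewrite mulr_sumr -big_split mulr_suml.
    by apply: eq_bigr => j _ /=; ring.
  move: lo.
  set A := \sum_(_ < _) _; set B := \sum_(_ < _) _.
  set A' := \sum_(_ < _) _; set B' := \sum_(_ < _) _; set C := \sum_(_ < _) _.
  move=> h1 h2; apply: (mulIf th1); rewrite mulrDl !divfK// /th -h1.
  have -> : C = - A' - s * v ord_max * (A + B) - B'.
    by rewrite h1 -[C]opprK -h2; ring.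
  by ring.
have := lopt _ l'c l'o l'n; rewrite leNgt => /negP; apply.
rewrite El; apply/bigmin_gtP; split=> [|j _]; first exact: ltry.
case: ifPn => bn0; first exact: ltry.
by rewrite lte_fin ltr_pdivlMr ?gap// lt_neqAle eq_sym bn0 b'0.
Qed.

(** * Uniqueness of [beta] on a small support *)

(** Pair [d] with the polynomial whose roots are the support points other than [j0]: its degree is
    below [p], so the pairing is zero, yet only the term at [j0] survives. *)
Lemma vanishing_moments (F : numDomainType) (n p : nat) (d : 'I_n -> F) :
  (#|[set j | d j != 0%R]| <= p)%N ->
  (forall i, (i < p)%N -> \sum_j d j * j%:R ^+ i = 0) ->
  forall j, d j = 0.
Proof.
set J := [set j | _] => Jp dm j0; apply/eqP; apply: contraT => dj0.
pose P : {poly F} := \prod_(j <- enum (J :\ j0)) ('X - (j%:R)%:P).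
have szP : (size P <= p)%N.
  rewrite size_prod_XsubC -cardE; apply: leq_trans Jp.
  by rewrite [in leqRHS](cardsD1 j0) inE dj0.
have : \sum_j d j * P.[j%:R] = 0.
  under eq_bigr do rewrite (horner_coef_wide _ szP) mulr_sumr.
  rewrite exchange_big big1// => i _.
  under eq_bigr do rewrite mulrCA.
  by rewrite -mulr_sumr dm ?mulr0.
rewrite (bigD1 j0)//= [X in _ + X]big1 ?addr0 => [/eqP|j jj0].
  rewrite mulf_eq0 (negPf dj0) /= horner_prod prodf_seq_eq0 => /hasP[j].
  rewrite mem_enum !inE hornerXsubC subr_eq0 eqr_nat.
  by move=> /andP[jj0 _] /eqP/val_inj jE; rewrite jE eqxx in jj0.
have [->|dj] := eqVneq (d j) 0; first by rewrite mul0r.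
apply/eqP; rewrite mulf_eq0 horner_prod prodf_seq_eq0; apply/orP; right.
apply/hasP; exists j; first by rewrite mem_enum !inE jj0 dj.
by rewrite hornerXsubC subrr eqxx.
Qed.

(** Subtracting the conditions of index [i + 1] cancels [alpha] and leaves [i + 1] times the [i]-th
    moment of [beta - hbeta]. *)
Lemma order_conditions_beta_inj (R : realType) (k p : nat) (alpha : 'I_k -> R)
    (beta hbeta : 'I_k.+1 -> R) : (1 <= p)%N ->
  order_conditions p alpha beta -> order_conditions p alpha hbeta ->
  (#|[set j | (beta j - hbeta j)%R != 0%R]| <= p)%N -> beta = hbeta.
Proof.
move=> p1 /(order_conditionsP _ _ p1) h1.
move=> /(order_conditionsP _ _ p1) h2 cJ.
apply/funext => j; apply/eqP; rewrite -subr_eq0; apply/eqP.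
move: j; apply: (@vanishing_moments _ _ p) => // i ip.
have i0 : i.+1%:R != 0 :> R by rewrite pnatr_eq0.
apply: (mulfI i0); rewrite mulr0 mulr_sumr.
transitivity (\sum_(j < k.+1) beta j * i.+1%:R * j%:R ^+ i
  - \sum_(j < k.+1) hbeta j * i.+1%:R * j%:R ^+ i).
  by rewrite -sumrB; apply: eq_bigr => j _; ring.
have := h1 i.+1 ip; have := h2 i.+1 ip.
set A := \sum_(_ < _) _; rewrite /=; set B := \sum_(_ < _) _.
set D := \sum_(_ < _) _ => e2 e1.
have -> : B = k%:R ^+ i.+1 - A by rewrite -e2; ring.
have -> : D = k%:R ^+ i.+1 - A by rewrite -e1; ring.
by ring.
Qed.

(** * Transfer of optimality *)

(** If the best coefficient were not positive, the set of positive coefficients would be empty and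
    its supremum [-oo], while an SSP method has a nonnegative coefficient. *)
Lemma almm_optimal_coef_gt0 (R : realType) (c : method_class) (k p : nat)
    (y : R) (m : almm R k) : 0 <= y ->
  almm_optimal c p y m -> (0 < almm_ssp_coef y m)%E.
Proof.
move=> y0 [_ _ /almm_ssp_mono0 m0 mE].
have c0 : (0 <= almm_ssp_coef y m)%E.
  by apply: ereal_sup_ubound; exists 0 => //; split=> //; rewrite mulr0.
rewrite ltNge; apply/negP => cle; move: c0; rewrite mE leNgt => /negP; apply.
rewrite /almm_best_coef (_ : [set x | _]%classic = set0) ?ereal_sup0 ?ltNyr//.
apply/seteqP; split=> // x [x0 hx].
suff : (x <= 0)%E by rewrite leNgt x0.
by apply: le_trans cle; rewrite mE; apply: ereal_sup_ubound.
Qed.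

Lemma almm_of_lmm_mono0 (R : realType) (k : nat) (l : lmm R k) :
  lmm_nonneg l -> monotonicity_conditions (almm_of_lmm l) 0 0.
Proof.
by move=> [a0 b0]; split=> j //=; rewrite !mul0r !subr0.
Qed.

Lemma almm_of_lmm_ssp_coef (R : realType) (k : nat) (y : R) (l : lmm R k) :
  0 <= y -> lmm_nonneg l ->
  lmm_ssp_coef l = ((1 + y)%:E * almm_ssp_coef y (almm_of_lmm l))%E.
Proof.
move=> y0 l0; rewrite -blend_ssp_coef ?blend_almm_of_lmm//.
exact: almm_of_lmm_mono0.
Qed.

Lemma almm_of_lmm_in_class (R : realType) (c : method_class) (k : nat)
    (l : lmm R k) : lmm_in_class c l -> almm_in_class c (almm_of_lmm l).
Proof. by case: c. Qed.

(** A competitor used for both parts is an additive method with coefficient divided by [1 + y]; if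
    positive, it is bounded by the supremum that [m] attains. *)
Lemma blend_optimal (R : realType) (c : method_class) (k p : nat) (y : R)
    (m : almm R k) : (1 <= p)%N -> 0 <= y ->
  almm_optimal c p y m -> lmm_optimal c p (blend y m).
Proof.
move=> p1 y0 mopt; have m_gt0 := almm_optimal_coef_gt0 y0 mopt.
have [mc mo /almm_ssp_mono0 m0 mE] := mopt.
have y1 : 0 < 1 + y by rewrite ltr_pwDl.
split; [exact: blend_in_class|exact: blend_order|exact: blend_nonneg|].
move=> l lc lo l0; rewrite blend_ssp_coef// (almm_of_lmm_ssp_coef y0)//.
rewrite lee_pmul2l//.
have [le0 | gt0] := leP (almm_ssp_coef y (almm_of_lmm l)) 0%E.
  exact: (le_trans le0 (ltW m_gt0)).
rewrite mE; apply: ereal_sup_ubound; split=> //.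
by exists (almm_of_lmm l); split=> //; exact: almm_of_lmm_in_class.
Qed.

(** Since [y > 0] and both parts are nonnegative, a zero of the averaged [beta] is a zero of both,
    so the support bound carries over to [beta - hbeta]. *)
Lemma almm_optimal_beta_eq (R : realType) (c : method_class) (k p : nat)
    (y : R) (m : almm R k) : (1 <= p)%N -> 0 < y ->
  almm_optimal c p y m -> almm_beta m = almm_hbeta m.
Proof.
move=> p1 y0 mopt; have [_ mo /almm_ssp_mono0 m0 _] := mopt.
have [mob moh] := mo.
have y1 : 0 < 1 + y by rewrite ltr_wpDr// ltW.
apply: (order_conditions_beta_inj p1 mob moh).
apply: leq_trans (lmm_optimal_support p1
  (blend_optimal p1 (ltW y0) mopt) _); last first.
  rewrite blend_ssp_coef ?(ltW y0)// mule_gt0 ?lte_fin//.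
  exact: almm_optimal_coef_gt0 (ltW y0) mopt.
apply: subset_leq_card; apply/fintype.subsetP => j; rewrite !inE /=.
apply: contraNN; have [b1 b2] := m0.1 j.
rewrite mulf_eq0 invr_eq0 (gt_eqF y1) orbF paddr_eq0 ?mulr_ge0 ?(ltW y0)//.
by rewrite mulf_eq0 (gt_eqF y0) /= => /andP[/eqP -> /eqP ->]; rewrite subrr.
Qed.

Lemma almm_optimal_blendE (R : realType) (c : method_class) (k p : nat)
    (y : R) (m : almm R k) : (1 <= p)%N -> 0 <= y ->
  almm_optimal c p y m -> blend y m = lmm_of_almm m.
Proof.
move=> p1; rewrite le_eqVlt => /predU1P[<-|y0] mopt.
  (* At [y = 0] the average has weights 1 : 0 and is [beta] itself. *)
  congr LMM; apply/funext => j.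
  by rewrite mul0r addr0 addr0 divr1.
have be := almm_optimal_beta_eq p1 y0 mopt.
rewrite -(blend_almm_of_lmm (lmm_of_almm m) (ltW y0)).
by rewrite /blend /= -be.
Qed.

(** At [y = 0], where optimality does not determine [hbeta], equivalence means that replacing
    [hbeta] by [beta] keeps the method optimal. *)
Theorem theorem3p2 (R : realType) (c : method_class) (k p : nat) (y : R)
    (hk : (1 <= k)%N) (hp : (1 <= p)%N) (hy : 0 <= y)
    (m : almm R k) (hm : almm_optimal c p y m) :
  [/\ 0 < y -> forall j, almm_beta m j = almm_hbeta m j,
      almm_optimal c p y (almm_of_lmm (lmm_of_almm m)),
      lmm_optimal c p (lmm_of_almm m)
    & lmm_ssp_coef (lmm_of_almm m)
      = (almm_best_coef c k p y + y%:E * almm_best_coef c k p y)%E].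
Proof.
have bE := almm_optimal_blendE hp hy hm.
have lopt := blend_optimal hp hy hm; rewrite bE in lopt.
have [mc mo /almm_ssp_mono0 m0 mE] := hm; have [lc lo ln _] := lopt.
have lE : lmm_ssp_coef (lmm_of_almm m) = ((1 + y)%:E * almm_ssp_coef y m)%E.
  by rewrite -bE blend_ssp_coef.
have y1 : 0 < 1 + y by rewrite ltr_pwDl.
split=> //.
- by move=> y0 j; rewrite (almm_optimal_beta_eq hp y0 hm).
- split=> //; first exact: almm_of_lmm_in_class.
    by exists 0, 0; split=> //; exact: almm_of_lmm_mono0.
  (* Both additive coefficients, multiplied by [1 + y], give that of [lmm_of_almm m]. *)
  rewrite -mE; apply/le_anti/andP.
  by split; rewrite -(@lee_pmul2l _ (1 + y)%:E)// -lE -almm_of_lmm_ssp_coef.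
- by rewrite lE -mE EFinD ge0_muleDl ?mul1e ?lee_fin.
Qed.
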